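(* Let $n\ge1$ and $\alpha=(\alpha_1,\dots,\alpha_n)\in\mathbb{R}^n$ with $\alpha\ne0$. Let $J(t)=\cosh(\alpha\cdot t)-1$ on $\mathbb{R}^n$, with Hessian metric $g_{ij}(t)=\frac{\partial^2 J}{\partial t_i\partial t_j}(t)=\cosh(\alpha\cdot t)\,\alpha_i\alpha_j$. Consider the family of normal densities on $\mathbb{R}$, parametrized by $t\in\mathbb{R}^n$, $$p(z;t)=\frac{1}{\sqrt{2\pi}}\exp\left(-\frac{(z-m(\alpha\cdot t))^2}{2}\right),\qquad m(S)=\int_0^S\sqrt{\cosh u}\,du .$$ Then the Fisher information matrix $I_{ij}(t)$ of this family satisfies $$I_{ij}(t)=\cosh(\alpha\cdot t)\,\alpha_i\alpha_j=g_{ij}(t)\qquad\text{for all }t\in\mathbb{R}^n,\ 1\le i,j\le n.$$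
   Context: $\alpha\cdot t=\sum_{i=1}^n\alpha_it_i$. The Fisher information matrix of a parametrized family of densities $p(z;t)$ is $I_{ij}(t)=\int_{\mathbb{R}}\frac{\partial\log p(z;t)}{\partial t_i}\frac{\partial\log p(z;t)}{\partial t_j}\,p(z;t)\,dz$. *)

(* Defs.v *)
From HB Require Import structures.
From mathcomp Require Import all_boot all_order all_algebra.
From mathcomp Require Import all_classical all_reals all_analysis.

Set Implicit Arguments.
Unset Strict Implicit.
Unset Printing Implicit Defensive.

Import Order.TTheory GRing.Theory Num.Theory.
Import numFieldNormedType.Exports.

Local Open Scope classical_set_scope.
Local Open Scope ring_scope.

Definition cosh (R : realType) (x : R) : R := (expR x + expR (- x)) / 2.

Definition dotv (R : realType) (n : nat) (a t : 'rV[R]_n) : R :=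
  \sum_(i < n) a 0 i * t 0 i.

(* Derivatives of real functions on R^n along the standard basis vectors; as
   with the library's ['D_v], the values are only meaningful when the
   corresponding difference quotients converge. *)
Definition partial_derivable (R : realType) (n : nat) (f : 'rV[R]_n -> R)
    (t : 'rV[R]_n) (i : 'I_n) : Prop :=
  derivable f t (delta_mx 0 i).

Definition partial (R : realType) (n : nat) (i : 'I_n) (f : 'rV[R]_n -> R)
    (t : 'rV[R]_n) : R :=
  'D_(delta_mx 0 i) f t.

Definition has_hessian (R : realType) (n : nat) (f : 'rV[R]_n -> R)
    (t : 'rV[R]_n) : Prop :=
  (forall j s, partial_derivable f s j) /\
  (forall i j, partial_derivable (partial j f) t i).

Definition hessian (R : realType) (n : nat) (f : 'rV[R]_n -> R)
    (t : 'rV[R]_n) : 'M[R]_n :=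
  \matrix_(i, j) partial i (partial j f) t.

(* Integral of f from a to b, with the usual sign change when b < a. *)
Definition oriented_integral (R : realType) (f : R -> R) (a b : R) : R :=
  if a <= b then Rintegral lebesgue_measure `[a, b] f
  else - Rintegral lebesgue_measure `[b, a] f.

Definition fisher_integrand (R : realType) (n : nat)
    (p : R -> 'rV[R]_n -> R) (t : 'rV[R]_n) (i j : 'I_n) (z : R) : R :=
  partial i (fun s => ln (p z s)) t * partial j (fun s => ln (p z s)) t * p z t.

(* The score exists and all entries of the information matrix are finite, so
   that [fisher_information] below involves no default values. *)
Definition has_fisher_information (R : realType) (n : nat)
    (p : R -> 'rV[R]_n -> R) (t : 'rV[R]_n) : Prop :=
  (forall i z, partial_derivable (fun s => ln (p z s)) t i) /\
  (forall i j, (@lebesgue_measure R).-integrable setT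
                 (EFin \o fisher_integrand p t i j)).

Definition fisher_information (R : realType) (n : nat)
    (p : R -> 'rV[R]_n -> R) (t : 'rV[R]_n) : 'M[R]_n :=
  \matrix_(i, j) Rintegral lebesgue_measure setT (fisher_integrand p t i j).

Definition potential (R : realType) (n : nat) (alpha t : 'rV[R]_n) : R :=
  cosh (dotv alpha t) - 1.

Definition mean_fun (R : realType) (S : R) : R :=
  oriented_integral (fun u => Num.sqrt (cosh u)) 0 S.

Definition normal_family (R : realType) (n : nat) (alpha : 'rV[R]_n)
    (z : R) (t : 'rV[R]_n) : R :=
  (Num.sqrt (2 * pi))^-1 * expR (- ((z - mean_fun (dotv alpha t)) ^+ 2 / 2)).

Lemma normal_familyE (R : realType) (n : nat) (alpha : 'rV[R]_n)
    (z : R) (t : 'rV[R]_n) :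
  normal_family alpha z t = normal_pdf (mean_fun (dotv alpha t)) 1 z.
Proof.
rewrite normal_pdfE ?oner_neq0// /normal_family /normal_peak /normal_fun.
by rewrite expr1n mul1r mulr_natl mulNr.
Qed.

(* Main.v *)
Require Import Defs.
From HB Require Import structures.
From mathcomp Require Import all_boot all_order all_algebra.
From mathcomp Require Import all_classical all_reals all_analysis.
From mathcomp Require Import measurable_realfun ring lra.

Set Implicit Arguments.
Unset Strict Implicit.
Unset Printing Implicit Defensive.

Import Order.TTheory GRing.Theory Num.Theory.
Import numFieldNormedType.Exports.

Local Open Scope classical_set_scope.
Local Open Scope ring_scope.

(* Along [delta_mx 0 i], a function of [alpha . t] differentiates by the
   one-variable chain rule. As [m' = sqrt cosh], the score is
   [(z - m) * sqrt (cosh (alpha . t)) * alpha_i], so that every Fisher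
   integrand is [cosh (alpha . t) * alpha_i * alpha_j] times
   [(z - m)^2 * normal_pdf m 1 z], and the theorem reduces to the variance of
   the unit normal law being 1. *)

(** * Directional derivatives of functions of [alpha . t] *)

(** The difference quotient of [f] at [x] along [v] is that at [0] of its restriction to the line
    [h *: v + x]. *)
Lemma is_derive_along (R : numFieldType) (V W : normedModType R)
    (f : V -> W) (x v : V) (D : W) :
  is_derive (0 : R) 1 (fun h : R => f (h *: v + x)) D -> is_derive x v f D.
Proof.
case=> df <-; split; first exact/derivable1P.
rewrite /derive; set g := fun h => h^-1 *: _; set g' := fun h => h^-1 *: _.
suff -> : g = g' by [].
by apply/funext => h; rewrite /g /g' /= addr0 scale0r add0r [h *: 1]mulr1.
Qed.

Lemma dotv_line (R : realType) (n : nat) (a t : 'rV[R]_n) (i : 'I_n) (h : R) :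
  dotv a (h *: delta_mx 0 i + t) = h * a 0 i + dotv a t.
Proof.
rewrite /dotv.
under eq_bigr do rewrite !mxE mulrDr.
rewrite big_split /=; congr (_ + _).
rewrite (bigD1 i) //= !eqxx mulr1 mulrC big1 ?addr0// => j /negbTE ->.
by rewrite ?andbF !mulr0.
Qed.

Lemma is_derive_dotv (R : realType) (n : nat) (F : R -> R) (a t : 'rV[R]_n)
    (i : 'I_n) (D : R) :
  is_derive (dotv a t) 1 F D ->
  is_derive t (delta_mx 0 i) (fun s => F (dotv a s)) (D * a 0 i).
Proof.
move=> dF; apply: is_derive_along.
rewrite (_ : (fun h => _) = F \o (fun h : R => h * a 0 i + dotv a t)); last first.
  by apply/funext => h /=; rewrite dotv_line.
apply: is_derive1_comp; first by rewrite mul0r add0r.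
apply: is_derive_eq.
by rewrite scaler0 add0r addr0 [a 0 i *: 1]mulr1.
Qed.

(** * Derivatives of oriented integrals, [cosh] and [mean_fun] *)

Lemma is_derive_oriented_integral (R : realType) (f : R -> R) (a x : R) :
  continuous f -> is_derive x 1 (oriented_integral f a) (f x).
Proof.
move=> cf.
have intf (u v : R) :
    (@lebesgue_measure R).-integrable `[u, v]%classic (EFin \o f).
  apply: continuous_compact_integrable; first exact: segment_compact.
  exact: continuous_subspaceT.
(* A common lower bound turns both branches of [oriented_integral f a] near [x]
   into [F y - F a] with a single primitive [F]. *)
pose b := Num.min a x - 1.
have ba : b < a by rewrite /b; case: (leP a x) => ?; lra.
have bx : b < x by rewrite /b; case: (leP a x) => ?; lra.
pose F y := (\int[lebesgue_measure]_(t in `[b, y]) f t)%R.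
(* The right end [x + 1] only makes [x] interior to the interval of integration. *)
have [dF F'] := @continuous_FTC1_closed R f b x (x + 1)
  (ltr_pwDr ltr01 (lexx _)) (intf _ _) bx (cf x).
have split_itv (u v : R) : b < u -> u <= v ->
    F v - F u = (\int[lebesgue_measure]_(t in `[u, v]) f t)%R.
  move=> bu uv; rewrite /F Rintegral_itvB ?bnd_simp ?(ltW bu)//.
  rewrite Rintegral_itv_obnd_cbnd//.
  by apply: integrableS (intf u v) => //; apply: subset_itv; rewrite bnd_simp.
apply: (@near_eq_is_derive _ _ _ (fun y => F y - F a)).
  near=> y; have by' : b < y by near: y; exact: lt_nbhsr.
  rewrite /oriented_integral; case: (leP a y) => [ay|/ltW ya].
    exact: split_itv.
  by rewrite -split_itv// opprB.
have ? : is_derive x 1 F (f x) by split => //; rewrite -derive1E.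
by apply: is_derive_eq; rewrite subr0.
Unshelve. all: end_near. Qed.

Lemma is_derive_cosh (R : realType) (x : R) :
  is_derive x 1 (@cosh R) ((expR x - expR (- x)) / 2).
Proof.
rewrite /cosh; apply: is_derive_eq.
rewrite /= /GRing.scale /= ?addr0; by field.
Qed.

Lemma is_derive_sinh (R : realType) (x : R) :
  is_derive x 1 (fun x : R => (expR x - expR (- x)) / 2) (cosh x).
Proof.
apply: is_derive_eq.
rewrite /= /GRing.scale /= /cosh ?addr0; by field.
Qed.

Lemma cosh_gt0 (R : realType) (x : R) : 0 < cosh x.
Proof. by rewrite divr_gt0// addr_gt0// expR_gt0. Qed.

Lemma continuous_cosh (R : realType) : continuous (@cosh R).
Proof.
move=> x; apply/differentiable_continuous/derivable1_diffP.
by have [] := is_derive_cosh x.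
Qed.

Lemma is_derive_mean_fun (R : realType) (x : R) :
  is_derive x 1 (@mean_fun R) (Num.sqrt (cosh x)).
Proof.
apply: is_derive_oriented_integral => y.
apply: (@continuous_comp _ _ _ (@cosh R) Num.sqrt); first exact: continuous_cosh.
exact: sqrt_continuous.
Qed.

(** * Second moment of the unit normal law *)

Section normal_second_moment.
Context {R : realType}.
Local Notation mu := (@lebesgue_measure R).

Local Notation phi := (normal_pdf (0 : R) 1).

(** The cumulative distribution function of the standard normal law. *)
Let Phi (x : R) : R := (\int[mu]_(t in `]-oo, x]) phi t)%R.

Let continuous_phi : continuous phi.
Proof. exact/continuous_normal_pdf/oner_neq0. Qed.

Let phiN (x : R) : phi (- x) = phi x.
Proof. by rewrite normal_pdfE ?oner_neq0// /normal_fun !subr0 sqrrN. Qed.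

Let is_derive_phi (x : R) : is_derive x 1 phi (- x * phi x).
Proof.
rewrite normal_pdfE ?oner_neq0// /normal_fun.
apply: is_derive_eq.
rewrite /= /GRing.scale /= !subr0 expr1n; by field.
Qed.

Let is_derive_Phi (x : R) : is_derive x 1 Phi (phi x).
Proof.
have intphi (A : set R) : measurable A -> mu.-integrable A (EFin \o phi).
  move=> mA; apply: (integrableS measurableT) => //.
  exact: integrable_normal_pdf.
have [] := @continuous_FTC1 R phi -oo%O x (x + 1) (ltr_pwDr ltr01 (lexx _))
  (intphi _ (measurable_itv _)) (ltNyr _) (@continuous_phi x).
by move=> ? ?; split => //; rewrite -derive1E.
Qed.

Let cvg_Phi : Phi x @[x --> +oo] --> (1 : R).
Proof.
(* [normal_prob] lives on [measurableTypeR R], random variables take values in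
   the default measurable structure of [R]: hence the explicit displays. *)
have mid : @measurable_fun _ default_measure_display (measurableTypeR R) R
    setT (fun x => x).
  exact: measurable_id.
(* Up to conversion, [Phi] is the distribution function of the identity variable under
   [normal_prob 0 1]. *)
have := fine_cvg (@cvg_cdfy1 _ _ _ (normal_prob (0 : R) 1)
  (@mfun_Sub _ default_measure_display (measurableTypeR R) R _ (mem_set mid))).
exact.
Qed.

Let cvg_xphi : x * phi x @[x --> +oo] --> (0 : R).
Proof.
pose c := @normal_peak R 1.
have c0 : 0 <= c by exact: normal_peak_ge0.
apply: (@squeeze_cvgr _ _ _ _ (cst 0) (fun x => c * expR (- x))).
(* From 4 on, [x - x ^+ 2 / 2 <= - x]; bounding the factor [x] by [expR x] then gives the majorant
   [c * expR (- x)]. *)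
- near=> x; have x4 : 4 <= x by near: x; exact: nbhs_pinfty_ge.
  have x0 : 0 <= x by lra.
  rewrite mulr_ge0 ?normal_pdf_ge0//=.
  rewrite normal_pdfE ?oner_neq0// mulrCA ler_wpM2l//.
  rewrite /normal_fun subr0 expr1n.
  have xe : x <= expR x by apply: le_trans (expR_ge1Dx x); lra.
  apply: (@le_trans _ _ (expR x * expR (- x ^+ 2 / 2))).
    by rewrite ler_wpM2r// expR_ge0.
  by rewrite -expRD ler_expR; nra.
- exact: cvg_cst.
- rewrite -[X in _ --> X](mulr0 c); apply: cvgM; first exact: cvg_cst.
  exact: cvgr_expR.
Unshelve. all: end_near. Qed.

(* Both the total mass and the second moment of [phi] are twice an integral
   over the half line, with primitives [Phi] and [Phi - x phi x]; these have
   the same limit at infinity and the same value at [0]. *)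
Let integral_sqr_phi : (\int[mu]_x (x ^+ 2 * phi x)%:E = 1)%E.
Proof.
have halfline (f F : R -> R) : (forall x, 0 <= f x) -> continuous f ->
    (forall x, f (- x) = f x) -> F x @[x --> +oo] --> (1 : R) ->
    (forall x : R, is_derive x 1 F (f x)) ->
    (\int[mu]_x (f x)%:E = 2%:E * (1 - (F 0)%:E))%E.
  move=> f0 cf fN F1 dF.
  rewrite ge0_symfun_integralT//; last by move=> x /=; rewrite fN.
  rewrite -set_itvcy (@ge0_continuous_FTC2y _ f F 0 1)//.
  - exact: continuous_subspaceT.
  - apply: cvg_at_right_filter.
    by apply/differentiable_continuous/derivable1_diffP; have [] := dF 0.
  - by move=> x _; rewrite derive1E; have [] := dF x.
(* Reading the target 1 as the total mass of [phi] turns both sides into [2 * (1 - Phi 0)], so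
   [Phi 0] is never evaluated. *)
have <- := integral_normal_pdf (0 : R) 1.
rewrite (halfline phi Phi _ _ _ _ is_derive_Phi)//; last exact: normal_pdf_ge0.
have dPsi (x : R) : is_derive x 1 (fun x => Phi x - x * phi x) (x ^+ 2 * phi x).
  have := is_derive_Phi x; have := is_derive_phi x => ? ?.
  by apply: is_derive_eq; rewrite /= /GRing.scale /=; ring.
rewrite (halfline (fun x => x ^+ 2 * phi x) (fun x => Phi x - x * phi x)
  _ _ _ _ dPsi).
- by rewrite mul0r subr0.
- by move=> x; rewrite mulr_ge0 ?sqr_ge0 ?normal_pdf_ge0.
- by move=> x; apply: cvgM; [exact: exprn_continuous|exact: continuous_phi].
- by move=> x; rewrite sqrrN phiN.
- by rewrite -[X in _ --> X](subr0 1); exact: cvgB.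
Qed.

(** The substitution [x - m], of derivative 1, reduces this to the centred case. *)
Lemma integral_sqr_normal_pdf (m : R) :
  (\int[mu]_x ((x - m) ^+ 2 * normal_pdf m 1 x)%:E = 1)%E.
Proof.
rewrite -integral_sqr_phi.
have dF (x : R) : is_derive x 1 (fun x : R => x - m) 1.
  by apply: is_derive_eq; rewrite subr0.
have F' : (fun x : R => x - m)^`()%classic = cst 1.
  by apply/funext => x; rewrite derive1E; have [] := dF x.
rewrite (@increasing_ge0_integration_by_substitutionT R (fun x => x - m)
  (fun x => x ^+ 2 * phi x)) ?F'.
- apply: eq_integral => x _ /=; rewrite !fctE /= mulr1.
  by rewrite !normal_pdfE ?oner_neq0// /normal_fun subr0.
- by move=> x y xy; rewrite ltrD2r.
- by move=> x; exact: cvg_cst.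
- exact: is_cvg_cst.
- exact: is_cvg_cst.
- by move=> x; have [] := dF x.
- exact: cvg_addrr_Ny.
- exact: cvg_addrr.
- by move=> x; apply: cvgM; [exact: exprn_continuous|exact: continuous_phi].
- by move=> x; rewrite mulr_ge0 ?sqr_ge0 ?normal_pdf_ge0.
Qed.

(** The integrand is nonnegative, so the integral of its absolute value is the second moment 1,
    which is finite. *)
Lemma integrable_sqr_normal_pdf (m : R) :
  mu.-integrable setT (fun x : R => ((x - m) ^+ 2 * normal_pdf m 1 x)%:E).
Proof.
pose f (x : R) := (x - m) ^+ 2 * normal_pdf m 1 x.
have mf : measurable_fun setT f.
  apply: measurable_funM; last exact: measurable_normal_pdf.
  by apply: measurable_funX; exact: measurable_funB.
apply/integrableP; split; first exact/measurable_EFinP.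
rewrite (eq_integral (fun x : measurableTypeR R => (f x)%:E)).
  by rewrite integral_sqr_normal_pdf ltry.
move=> x _.
by rewrite /= ger0_norm// mulr_ge0 ?sqr_ge0 ?normal_pdf_ge0.
Qed.

End normal_second_moment.

(** * Score and Fisher integrand of the family *)

Lemma is_derive_ln_normal_family (R : realType) (n : nat) (alpha t : 'rV[R]_n)
    (i : 'I_n) (z : R) :
  is_derive t (delta_mx 0 i) (fun s => ln (normal_family alpha z s))
    ((z - mean_fun (dotv alpha t)) * Num.sqrt (cosh (dotv alpha t))
       * alpha 0 i).
Proof.
pose c : R := (Num.sqrt (2 * pi))^-1.
have c0 : 0 < c by rewrite invr_gt0 sqrtr_gt0 mulr_gt0// pi_gt0.
(* The logarithm cancels the exponential, leaving a constant minus a quadratic in [mean_fun]. *)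
have -> : (fun s => ln (normal_family alpha z s)) =
    (fun s => ln c - (z - mean_fun (dotv alpha s)) ^+ 2 / 2).
  by apply/funext => s; rewrite lnM ?posrE ?expR_gt0// expRK.
apply: (@is_derive_dotv R n (fun S => ln c - (z - mean_fun S) ^+ 2 / 2)).
have dm := is_derive_mean_fun (dotv alpha t).
apply: is_derive_eq.
rewrite /= /GRing.scale /=; by field.
Qed.

Lemma fisher_integrand_normal_family (R : realType) (n : nat)
    (alpha t : 'rV[R]_n) (i j : 'I_n) :
  fisher_integrand (normal_family alpha) t i j =
  fun z => cosh (dotv alpha t) * (alpha 0 i * alpha 0 j) *
    ((z - mean_fun (dotv alpha t)) ^+ 2 *
       normal_pdf (mean_fun (dotv alpha t)) 1 z).
Proof.
apply/funext => z; rewrite /fisher_integrand /partial.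
rewrite !(derive_val (is_derive := is_derive_ln_normal_family _ _ _ _)).
(* Each score contributes one factor [Num.sqrt (cosh _)]; positivity of [cosh] makes their product
   [cosh] itself. *)
rewrite normal_familyE -[cosh _ in RHS](sqr_sqrtr (ltW (cosh_gt0 _))).
by ring.
Qed.

(** * Hessian of the potential *)

Lemma is_derive_potential (R : realType) (n : nat) (alpha : 'rV[R]_n) (j : 'I_n)
    (t : 'rV[R]_n) :
  is_derive t (delta_mx 0 j) (potential alpha)
    ((expR (dotv alpha t) - expR (- dotv alpha t)) / 2 * alpha 0 j).
Proof.
apply: (@is_derive_dotv R n (fun S => cosh S - 1)).
have dc := is_derive_cosh (dotv alpha t).
by apply: is_derive_eq; rewrite subr0.
Qed.

Lemma is_derive_partial_potential (R : realType) (n : nat) (alpha : 'rV[R]_n)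
    (i j : 'I_n) (t : 'rV[R]_n) :
  is_derive t (delta_mx 0 i) (partial j (potential alpha))
    (cosh (dotv alpha t) * (alpha 0 i * alpha 0 j)).
Proof.
rewrite (_ : partial j _ = fun s =>
    (expR (dotv alpha s) - expR (- dotv alpha s)) / 2 * alpha 0 j); last first.
  by apply/funext => s; have [] := is_derive_potential alpha j s.
(* Brings [alpha 0 i] to the far right, as the chain rule [is_derive_dotv] produces it. *)
rewrite mulrCA mulrC.
apply: (@is_derive_dotv R n (fun S => (expR S - expR (- S)) / 2 * alpha 0 j)).
have ds := is_derive_sinh (dotv alpha t).
apply: is_derive_eq; rewrite /= /GRing.scale /=; ring.
Qed.

Theorem mainTheorem3 (R : realType) (n : nat) (hn : (1 <= n)%N)
    (alpha : 'rV[R]_n) (halpha : alpha <> 0) (t : 'rV[R]_n) :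
  [/\ has_hessian (potential alpha) t,
      has_fisher_information (normal_family alpha) t
    & forall i j : 'I_n,
        fisher_information (normal_family alpha) t i j
          = cosh (dotv alpha t) * (alpha 0 i * alpha 0 j)
        /\ cosh (dotv alpha t) * (alpha 0 i * alpha 0 j)
          = hessian (potential alpha) t i j].
Proof.
have int2 := integrable_sqr_normal_pdf (mean_fun (dotv alpha t)).
split.
- split=> [j s|i j]; first by have [] := is_derive_potential alpha j s.
  by have [] := is_derive_partial_potential alpha i j t.
- split=> [i z|i j]; first by have [] := is_derive_ln_normal_family alpha t i z.
  rewrite fisher_integrand_normal_family.
  exact: (integrableZl measurableT _ int2).
- move=> i j; rewrite !mxE; split; last first.
    by have [_ /esym] := is_derive_partial_potential alpha i j t.
  rewrite fisher_integrand_normal_family RintegralZl//.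
  by rewrite /Rintegral integral_sqr_normal_pdf mulr1.
Qed.
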